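(* Let $P \subset \mathbb{R}^d$ be a convex polytope that $k$-tiles $\mathbb{R}^d$ with a discrete multiset $\Lambda$. If every element of $\Lambda$ is contained in a lattice $\mathcal{L} \subset \mathbb{R}^d$, then $P$ $m$-tiles $\mathbb{R}^d$ with $\mathcal{L}$ for some positive integer $m$.
   Context: A lattice in $\mathbb{R}^d$ is the set of integer linear combinations of a basis of $\mathbb{R}^d$. $\partial P$ denotes the boundary of $P$ (closure minus interior), and $A + B = \{a+b : a \in A, b \in B\}$. For a positive integer $k$, a convex polytope $P \subset \mathbb{R}^d$ $k$-tiles $\mathbb{R}^d$ with a discrete multiset $\Lambda$ of vectors in $\mathbb{R}^d$ if $\sum_{\lambda \in \Lambda} \mathbf{1}_{P+\lambda}(v) = k$ for all $v \in \mathbb{R}^d$ with $v \notin \partial P + \Lambda$ (the sum counts multiplicities; $\mathbf{1}_X$ is the indicator function of $X$). A set is regarded as a multiset with all multiplicities $1$. *)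

(* Defs.v *)
From mathcomp Require Import all_boot all_order all_algebra.
From mathcomp Require Import all_classical all_reals all_analysis.

Set Implicit Arguments.
Unset Strict Implicit.
Unset Printing Implicit Defensive.

Import Order.TTheory GRing.Theory Num.Theory.
Import numFieldNormedType.Exports.

Local Open Scope classical_set_scope.
Local Open Scope ring_scope.

(* A multiset is its multiplicity function: every multiplicity is finite, but
   there may be infinitely many elements. *)
Definition multiset (T : Type) : Type := T -> nat.

Definition msupport (T : Type) (M : multiset T) : set T :=
  [set x | (0 < M x)%N].

Definition mset_of_set (T : Type) (A : set T) : multiset T :=
  fun x => nat_of_bool (x \in A).

(* [isolated A] is the set of isolated points of A, so this says that the
   subspace topology on A is discrete. *)
Definition is_discrete (T : topologicalType) (A : set T) : Prop :=
  A `<=` isolated A.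

Definition boundary (T : topologicalType) (A : set T) : set T :=
  closure A `\` interior A.

Definition minkowski_sum (V : zmodType) (A B : set V) : set V :=
  [set a + b | a in A & b in B].

Definition translate (V : zmodType) (A : set V) (t : V) : set V :=
  [set a + t | a in A].

Definition convex_hull (R : realType) (d n : nat) (p : 'I_n -> 'rV[R]_d) :
    set 'rV[R]_d :=
  [set x | exists w : 'I_n -> R,
    [/\ forall i, 0 <= w i, \sum_i w i = 1 & x = \sum_i w i *: p i]].

(* Neither nonemptiness nor full dimension is required here. *)
Definition convex_polytope (R : realType) (d : nat) (P : set 'rV[R]_d) : Prop :=
  exists (n : nat) (p : 'I_n -> 'rV[R]_d), P = convex_hull p.

Definition is_lattice (R : realType) (d : nat) (L : set 'rV[R]_d) : Prop :=
  exists n (b : n.-tuple 'rV[R]_d), basis_of fullv b /\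
    L = [set x | exists c : 'I_n -> int, x = \sum_i (c i)%:~R *: tnth b i].

(* The sum is taken in the extended reals, over all vectors weighted by their
   multiplicity, so that it makes sense without assuming finiteness; equality
   with k forces it to be finite. *)
Definition k_tiles (R : realType) (d k : nat) (P : set 'rV[R]_d)
    (Lambda : multiset 'rV[R]_d) : Prop :=
  is_discrete (msupport Lambda) /\
  forall v : 'rV[R]_d,
    ~ minkowski_sum (boundary P) (msupport Lambda) v ->
    \esum_(l in [set: 'rV[R]_d])
      ((Lambda l)%:R * \1_(translate P l) v)%:E = (k%:R)%:E :> \bar R.

(* Main.v *)
Require Import Defs.
From mathcomp Require Import finmap.
From mathcomp Require Import all_boot all_order all_algebra.
From mathcomp Require Import all_classical all_reals all_analysis.
From mathcomp Require Import zify.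

Import Order.TTheory GRing.Theory Num.Theory.
Import numFieldNormedType.Exports.

Local Open Scope classical_set_scope.
Local Open Scope ring_scope.

(** For generic [v] let [S_v = {l in L | v - l in P}], a finite set. Evaluating
    the tiling hypothesis at [v + a] with [a] in [L] gives
    [sum_(s in S_v) Lambda (s + a) = k]. For two generic points [v] and [v'],
    summing this over [a] in [S_v'] computes
    [sum_(s in S_v) sum_(a in S_v') Lambda (s + a)] as [k |S_v'|]; by symmetry
    it also equals [k |S_v|]. Hence [|S_v|], which is the number of
    [L]-translates of [P] covering [v], does not depend on [v]. *)

Lemma le_norm_entry {R : realType} {m n : nat} (x : 'M[R]_(m, n)) i j :
  `|x i j| <= `|x|.
Proof.
rewrite [leRHS]mx_normrE.
exact: (le_bigmax 0 (fun ij : 'I_m * 'I_n => `|x ij.1 ij.2|) (i, j)).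
Qed.

(** A coordinate is linear, so it is controlled by its values on the standard unit vectors. Summing
    these bounds over [i] gives one constant for all coordinates, and the added 1 makes it positive
    even when the sum is empty. *)
Lemma coord_le_norm {R : realType} {d n : nat} (b : n.-tuple 'rV[R]_d) :
  exists2 C : R, 0 < C & forall i x, `|coord b i x| <= C * `|x|.
Proof.
pose c i := \sum_j `|coord b i (delta_mx 0 j)|.
have c_ge0 i : 0 <= c i by exact: sumr_ge0.
exists (1 + \sum_i c i); first by rewrite ltr_pwDl// sumr_ge0.
move=> i x; apply: (@le_trans _ _ (c i * `|x|)); last first.
  rewrite ler_wpM2r// (bigD1 i)//= addrCA lerDl addr_ge0// sumr_ge0//.
rewrite {1}(row_sum_delta x) linear_sum mulr_suml.
apply: (le_trans (ler_norm_sum _ _ _)); apply: ler_sum => j _.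
by rewrite linearZ normrM mulrC ler_wpM2l// le_norm_entry.
Qed.

Lemma convex_polytope_bounded {R : realType} {d : nat} {P : set 'rV[R]_d} :
  convex_polytope P -> exists M : R, forall x, P x -> `|x| <= M.
Proof.
move=> [n [p ->]]; exists (\sum_i `|p i|) => x [w [w_ge0 w_sum1 ->]].
apply: (le_trans (ler_norm_sum _ _ _)); apply: ler_sum => i _.
rewrite normrZ ger0_norm// ler_piMl// -w_sum1 (bigD1 i)//= lerDl.
by rewrite sumr_ge0.
Qed.

Section Lattice.
Context {R : realType} {d : nat} {L : set 'rV[R]_d}.
Hypothesis latL : is_lattice L.

Lemma lattice0 : L 0.
Proof.
have [n [b [_ ->]]] := latL; exists (fun=> 0).
by rewrite big1// => i _; rewrite scale0r.
Qed.

Lemma latticeB x y : L x -> L y -> L (x - y).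
Proof.
have [n [b [_ ->]]] := latL => -[c ->] [c' ->]; exists (fun i => c i - c' i).
by rewrite -sumrB; apply: eq_bigr => i _; rewrite intrD rmorphN scalerBl.
Qed.

Lemma latticeN x : L x -> L (- x).
Proof. by rewrite -[- x]add0r; apply: latticeB; exact: lattice0. Qed.

Lemma latticeD x y : L x -> L y -> L (x + y).
Proof. by move=> Lx Ly; rewrite -[y]opprK; apply/latticeB/latticeN. Qed.

(** Quantitative form of discreteness: short lattice vectors have small integer coordinates. Both
    topological facts about [L] below rest on it. *)
Lemma lattice_bounded_coord :
  exists n (b : n.-tuple 'rV[R]_d) (C : R), 0 < C /\
    forall x, L x -> exists2 c : 'I_n -> int,
      x = \sum_i (c i)%:~R *: tnth b i & forall i, `|c i|%:~R <= C * `|x|.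
Proof.
have [n [b [bb ->]]] := latL; have [C C0 hC] := coord_le_norm b.
exists n, b, C; split=> // x [c xE]; exists c => // i.
rewrite intr_norm; have := hC i x; congr (`|_| <= _).
rewrite xE; under eq_bigr do rewrite (tnth_nth 0).
by rewrite coord_sum_free// (basis_free bb).
Qed.

Lemma lattice_discrete : is_discrete L.
Proof.
move=> x Lx; split; first by rewrite inE.
have [n [b [C [C0 hC]]]] := lattice_bounded_coord.
(* With radius [C^-1], the integer coordinates of [x - y] have absolute value below 1, so they
   vanish. *)
exists (ball x C^-1); first by apply: nbhsx_ballx; rewrite invr_gt0.
apply/seteqP; split=> [y [xy Ly]|_ ->]; last first.
  by split=> //; apply: ballxx; rewrite invr_gt0.
have [c yxE c_le] := hC _ (latticeB x y Lx Ly).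
suff c0 i : c i = 0.
  by apply/esym/eqP; rewrite -subr_eq0 yxE big1// => i _; rewrite c0 scale0r.
have : `|c i|%:~R < 1%:~R :> R.
  apply: (le_lt_trans (c_le i)); rewrite mulrC -ltr_pdivlMr// mul1r.
  by move: xy; rewrite -ball_normE.
by rewrite ltr_int; lia.
Qed.

Lemma lattice_bounded_finite (M : R) : finite_set (L `&` [set x | `|x| <= M]).
Proof.
have [n [b [C [C0 hC]]]] := lattice_bounded_coord.
(* [N] strictly exceeds [C * M], so every coordinate lies strictly between [-N] and [N]; shifting by
   [N] encodes it as an ordinal below [N + N]. *)
pose N := (Num.truncn (C * M)).+1.
pose f (c : {ffun 'I_n -> 'I_(N + N)}) : 'rV[R]_d :=
  \sum_i ((c i : nat)%:Z - N%:Z)%:~R *: tnth b i.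
apply: (@sub_finite_set _ _ (range f)); last exact: finite_image.
move=> x [/hC[c -> c_le] /= xM].
have cN i : `|c i| < N%:Z.
  rewrite -(ltr_int R); apply: le_lt_trans (c_le i) _.
  by apply: le_lt_trans (truncnS_gt _); rewrite ler_pM2l.
have cNN i : (`|(c i + N%:Z)%R| < N + N)%N by have := cN i; lia.
exists [ffun i => Ordinal (cNN i)] => //.
apply: eq_bigr => i _; rewrite ffunE /=; congr (_%:~R *: _).
by have := cN i; lia.
Qed.

End Lattice.

Section Coverings.
Context {R : realType} {d : nat} {P L : set 'rV[R]_d}.
Hypotheses (boundedP : exists M : R, forall x, P x -> `|x| <= M).
Hypothesis latL : is_lattice L.

(** The set [S_v] of the overview: [P (v - l)] means that [v] lies in [P + l]. *)
Definition covering (v : 'rV[R]_d) : set 'rV[R]_d :=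
  [set l | L l /\ P (v - l)].

Lemma covering_finite v : finite_set (covering v).
Proof.
have [M hM] := boundedP.
apply: sub_finite_set (lattice_bounded_finite latL (M + `|v|)).
move=> l [Ll /hM vlM]; split=> //=; rewrite -[l](subKr v).
by rewrite (le_trans (ler_normB _ _))// addrC lerD2r.
Qed.

(** Substitute [l = s + a]: the point [v + a] lies in [P + s + a] exactly when [v - s] is in [P].
    The weight [w] is kept general to serve both [Lambda] and [L] itself. *)
Lemma esum_translates (w : multiset 'rV[R]_d) (v a : 'rV[R]_d) :
    msupport w `<=` L -> L a ->
  \esum_(l in [set: 'rV[R]_d])
    ((w l)%:R * \1_(translate P l) (v + a))%:E =
  ((\sum_(s <- fset_set (covering v)) w (s + a)%R)%N%:R)%:E :> \bar R.
Proof.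
move=> wL La.
rewrite (reindex_esum setT setT (fun s => s + a)); last first.
  split=> // [x y _ _ /addIr//|y _].
  by exists (y - a) => //; rewrite subrK.
rewrite (eq_esum (b := fun s => if s \in covering v then
    (w (s + a))%:R%:E else 0%E)).
  rewrite -esum_mkcond esum_fset; [|exact: covering_finite|]; last first.
    by move=> s _; rewrite lee_fin.
  by rewrite fsbig_finite ?sumEFin ?natr_sum//; exact: covering_finite.
move=> s _.
have translateE : translate P (s + a) (v + a) = P (v - s).
  apply/propext; split=> [[p Pp pE]|Pvs].
    by rewrite (_ : v - s = p)// -(addrK a v) -pE addrA addrK addrK.
  by exists (v - s) => //; rewrite addrA subrK.
rewrite indicE; case: ifPn => [/set_mem[_ Pvs]|/negP sS].
  by rewrite mem_set ?mulr1// translateE.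
(* If [P] contains [v - s] although [s] is not in [covering v], then [s] is outside [L], hence so is
   [s + a], and its weight is zero. *)
have [/set_mem|] := boolP (v + a \in _); last by rewrite mulr0.
rewrite translateE mulr1 => Pvs; suff -> : w (s + a) = 0%N by [].
apply/eqP; rewrite eqn0Ngt; apply/negP => w_gt0; apply/sS/mem_set.
by split=> //; rewrite -(addrK a s); apply: latticeB => //; exact: wL.
Qed.

End Coverings.

Theorem corollary1p3 (R : realType) (d : nat) (P : set 'rV[R]_d)
    (k : nat) (Lambda : multiset 'rV[R]_d) (L : set 'rV[R]_d) :
  convex_polytope P ->
  (0 < k)%N ->
  k_tiles k P Lambda ->
  is_lattice L ->
  msupport Lambda `<=` L ->
  exists m : nat, (0 < m)%N /\ k_tiles m P (mset_of_set L).
Proof.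
move=> /convex_polytope_bounded bP k_gt0 [_ tilesP] latL LambdaL.
have suppL : msupport (mset_of_set L) = L.
  by apply/seteqP; split=> x; rewrite /msupport /mset_of_set /= lt0b inE.
(* Avoiding [boundary P + L], rather than only the translates by [Lambda], is a condition invariant
   under shifts by [L]; so the tiling hypothesis applies at every [v + a]. *)
pose generic v := ~ minkowski_sum (boundary P) L v.
pose S v := fset_set (@covering R d P L v).
have inS v l : l \in S v -> L l.
  by rewrite in_fset_set ?inE; [case|exact: covering_finite].
have sumS v a : generic v -> L a -> (\sum_(s <- S v) Lambda (s + a)%R)%N = k.
  move=> gv La; have := esum_translates bP latL Lambda v a LambdaL La.
  rewrite tilesP => [[/eqP]|]; first by rewrite eqr_nat => /eqP.
  move=> [p Pp [l /LambdaL Ll plE]]; apply: gv; exists p => //.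
  by exists (l - a); [exact: latticeB|rewrite addrA plE addrK].
have cardS v v' : generic v -> generic v' -> size (S v) = size (S v').
  move=> gv gv'; apply/eqP; rewrite -(eqn_pmul2l k_gt0); apply/eqP.
  (* Each inner sum is the tiling count at [u' + s], hence [k]. *)
  have card_sum u u' : generic u' ->
      (k * size (S u) = \sum_(s <- S u) \sum_(t <- S u') Lambda (t + s)%R)%N.
    move=> gu'; rewrite big_seq (eq_bigr (fun=> k)).
      by rewrite -big_seq big_const_seq count_predT iter_addn_0.
    by move=> s /inS Ls; rewrite sumS.
  rewrite (card_sum v v')// (card_sum v' v)// exchange_big/=.
  by apply: eq_bigr => s _; apply: eq_bigr => t _; rewrite addrC.
have tilesL m : (forall v, generic v -> size (S v) = m) ->
    k_tiles m P (mset_of_set L).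
  move=> mE; split=> [|v]; rewrite suppL; first exact: lattice_discrete.
  move=> gv; have := esum_translates bP latL (mset_of_set L) v 0.
  rewrite suppL addr0 => ->//; last exact: lattice0.
  rewrite -(mE _ gv) big_seq (eq_bigr (fun=> 1%N)).
    by rewrite -big_seq sum1_size.
  by move=> s /inS Ls; rewrite addr0 /mset_of_set mem_set.
(* Without generic points the tiling condition is vacuous, and any positive [m] works. *)
have [[v gv]|no_generic] := pselect (exists v, generic v); last first.
  by exists 1%N; split=> //; apply: tilesL => v gv; case: no_generic; exists v.
exists (size (S v)); split; last by apply: tilesL => u gu; exact: cardS.
(* An empty [S v] would make the tiling sum at [v] equal to 0 instead of [k]. *)
rewrite lt0n size_eq0; apply/negP => /eqP Sv0.
have := sumS v 0 gv (lattice0 latL); rewrite Sv0 big_nil => k0.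
by rewrite -k0 in k_gt0.
Qed.
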